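(* For all integers $n,\alpha,\gamma\geq 0$ and $\delta,\varepsilon\in\{0,1\}$, $$\begin{aligned}&\sum_{k=0}^n\binom{2n+2-\delta-\varepsilon}{2k+1-\delta}\frac{G_{2k+2\alpha+2}}{k+\alpha+1}\cdot\frac{G_{2n-2k+2\gamma+2}}{n-k+\gamma+1}\\&\quad=4\rho^{(0)}_{2\alpha+\delta,\,2\gamma+\varepsilon}\frac{G_{2n+2\alpha+2\gamma+4}}{n+\alpha+\gamma+2}+2\sum_{k=1}^{\alpha+\gamma+\lfloor(\delta+\varepsilon)/2\rfloor}\rho^{(k)}_{2\alpha+\delta,\,2\gamma+\varepsilon}\frac{B_{2k}}{k}\cdot\frac{G_{2n-2k+2\alpha+2\gamma+4}}{n-k+\alpha+\gamma+2}.\end{aligned}$$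
   Context: $B_n$ are the Bernoulli numbers, defined by $\frac{t}{e^t-1}=\sum_{n=0}^\infty B_n\frac{t^n}{n!}$, and $G_n$ are the Genocchi numbers, defined by $\frac{2t}{e^t+1}=\sum_{n=1}^\infty G_n\frac{t^n}{n!}$. For integers $a,b\geq 0$ the coefficients $\rho_{a,b}^{(k)}$ are defined by $\rho_{a,b}^{(0)}=\frac{a!\,b!}{(a+b+1)!}$ and, for $k\geq 1$, $\rho_{a,b}^{(k)}=(-1)^a\binom{b}{a+b+1-2k}+(-1)^b\binom{a}{a+b+1-2k}$, where a binomial coefficient $\binom{x}{y}$ with integers $x\geq 0$ and $y<0$ or $y>x$ is $0$. Empty sums are $0$. *)

(* Defs.v *)
From mathcomp Require Import all_boot all_order all_algebra.

Set Implicit Arguments.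
Unset Strict Implicit.
Unset Printing Implicit Defensive.

Import GRing.Theory Num.Theory.
Local Open Scope ring_scope.

(* A formal power series over rat is its sequence of coefficients.            *)
Definition fps := nat -> rat.

Definition fps_const (c : rat) : fps := fun n => if n == 0%N then c else 0.
Definition fps_t : fps := fun n => if n == 1%N then 1 else 0.
Definition fps_exp : fps := fun n => (n`!%:R)^-1.
Definition fps_add (f g : fps) : fps := fun n => f n + g n.
Definition fps_scale (c : rat) (f : fps) : fps := fun n => c * f n.
Definition fps_mul (f g : fps) : fps :=
  fun n => \sum_(i < n.+1) f i * g (n - i)%N.
(* (f - f(0)) / t *)
Definition fps_shift (f : fps) : fps := fun n => f n.+1.

(* f / g for g(0) <> 0: the coefficients q_i of the quotient are determined   *)
(* by f_n = \sum_(i <= n) q_i g_(n-i); fps_div_seq lists the first n of them. *)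
Fixpoint fps_div_seq (f g : fps) (n : nat) : seq rat :=
  if n is m.+1 then
    let q := fps_div_seq f g m in
    rcons q ((f m - \sum_(i < m) q`_i * g (m - i)%N) / g 0%N)
  else [::].
Definition fps_div (f g : fps) : fps := fun n => (fps_div_seq f g n.+1)`_n.

(* The series \sum_n a_n t^n / n! *)
Definition egf (a : nat -> rat) : fps := fun n => a n / n`!%:R.

(* t / (e^t - 1): numerator and denominator both have zero constant term and  *)
(* are divided by t, so that fps_div applies.                                 *)
Definition bernoulli_gf : fps :=
  fps_div (fps_shift fps_t) (fps_shift (fps_add fps_exp (fps_const (-1)))).
Definition bernoulli (n : nat) : rat := n`!%:R * bernoulli_gf n.

(* 2 t / (e^t + 1) *)
Definition genocchi_gf : fps :=
  fps_div (fps_scale 2 fps_t) (fps_add fps_exp (fps_const 1)).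
Definition genocchi (n : nat) : rat := n`!%:R * genocchi_gf n.

(* Binomial coefficient with integer lower index, zero when it is negative.   *)
Definition binz (x : nat) (y : int) : nat := if y is Posz m then 'C(x, m) else 0%N.

Definition rho (k a b : nat) : rat :=
  if k == 0%N then (a`! * b`!)%:R / ((a + b + 1)`!)%:R
  else (-1) ^+ a * (binz b (a%:Z + b%:Z + 1 - 2 * k%:Z))%:R
     + (-1) ^+ b * (binz a (a%:Z + b%:Z + 1 - 2 * k%:Z))%:R.

Lemma size_fps_div_seq f g n : size (fps_div_seq f g n) = n.
Proof. by elim: n => //= n IHn; rewrite size_rcons IHn. Qed.

Lemma nth_fps_div_seq f g n i : (i < n)%N -> (fps_div_seq f g n)`_i = fps_div f g i.
Proof.
elim: n => // n IHn; rewrite ltnS leq_eqVlt => /predU1P [-> //|lt_in].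
by rewrite /= nth_rcons size_fps_div_seq lt_in IHn.
Qed.

Lemma fps_divK f g n : g 0%N != 0 -> fps_mul (fps_div f g) g n = f n.
Proof.
move=> g0; rewrite /fps_mul big_ord_recr /= subnn.
rewrite {2}/fps_div /= nth_rcons size_fps_div_seq ltnn eqxx divfK //.
rewrite addrC -addrA [X in _ + X](_ : _ = 0) ?addr0 // addrC.
apply/eqP; rewrite subr_eq0; apply/eqP/eq_bigr => i _.
by rewrite nth_fps_div_seq.
Qed.

Lemma egf_fact (h : fps) n : egf (fun m => m`!%:R * h m) n = h n.
Proof. by rewrite /egf mulrC mulKf // pnatr_eq0 -lt0n fact_gt0. Qed.

Lemma bernoulliE n :
  fps_mul (egf bernoulli) (fps_add fps_exp (fps_const (-1))) n = fps_t n.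
Proof.
case: n => [|n].
  by rewrite /fps_mul big_ord1 /fps_add /fps_exp /fps_const /= invr1 subrr mulr0.
rewrite /fps_mul big_ord_recr /= subnn [X in _ + _ * X]/fps_add.
rewrite /fps_exp /fps_const /= invr1 subrr mulr0 addr0.
rewrite -[RHS]/(fps_shift fps_t n).
rewrite -(@fps_divK _ (fps_shift (fps_add fps_exp (fps_const (-1))))) //.
rewrite /fps_mul; apply: eq_bigr => i _.
by rewrite /bernoulli egf_fact subSn // -ltnS.
Qed.

Lemma genocchiE n :
  fps_mul (egf genocchi) (fps_add fps_exp (fps_const 1)) n = fps_scale 2 fps_t n.
Proof.
rewrite -[RHS](@fps_divK _ (fps_add fps_exp (fps_const 1))) //.
by apply: eq_bigr => i _; rewrite /genocchi egf_fact.
Qed.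

Lemma genocchi0 : genocchi 0 = 0.
Proof.
by rewrite /genocchi /genocchi_gf /fps_div /= big_ord0 /fps_scale /fps_t /= mulr0.
Qed.

(* Main.v *)
From HB Require Import structures.
Require Import Defs.
From mathcomp Require Import all_boot all_order all_algebra.
From mathcomp Require Import ring lra zify.

(** Let g(t) = 2 / (e^t + 1) - 1 = - tanh(t/2), so that the numbers
    G_(m+1) / (m+1) are the derivatives at 0 of 1 + g.  The Genocchi numbers of
    the theorem have even indices m + 1 >= 2, so that 1 + g may be replaced by g.
    After removal of the factor 4 the left-hand side is thus the N-th
    derivative at 0 of g^(a) g^(b), with a = 2 alpha + delta,
    b = 2 gamma + eps and N = 2n + 2 - delta - eps: the binomial sum is the
    Leibniz rule, and the indices j missing from it contribute 0 because g is
    odd.  So the theorem follows from a formula (dtanh_mul) that writes the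
    product g^(a) g^(b) as a linear combination of derivatives of g,

      g^(a) g^(b) = 2 rho_0 g^(a+b+1)
        + sum_(k >= 1) rho_k (B_2k / k) g^(a+b+1-2k) + [a = b = 0],

    by differentiating N times and evaluating at 0.

    All of this takes place among polynomials.  As g' = (g^2 - 1) / 2, every derivative of g is
    a polynomial in g; with D the derivation of Q[X] such that
    D X = (X^2 - 1) / 2, the polynomial of g^(a) is D^a X (dtanh a), and
    differentiating at t = 0 is applying D and evaluating at X = 0.

    The product formula is proved by induction on b.  Both sides obey the
    recursion F(a+1, b) + F(a, b+1) = D F(a, b): the left one by the Leibniz
    rule, the right one since rho_k(a+1, b) + rho_k(a, b+1) = rho_k(a, b) by
    Pascal's rule (rhoS).  For b = 0 the formula expresses the addition theorem
    of tanh, g(t) g(t+x) = 1 + coth(x/2) (g(t+x) - g(t)), expanded in powers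
    of x by the Bernoulli numbers.  Its form without denominator, multiplied by
    e^x - 1, is an identity between the polynomials D^j X and their binomial
    transform (binom_dtanh), which induction on the order proves; convolution
    with the Bernoulli numbers inverts the factor e^x - 1
    (bernoulli_binom_transform) and gives dtanh_mulX. *)

Set Implicit Arguments.
Unset Strict Implicit.
Unset Printing Implicit Defensive.

Import GRing.Theory Num.Theory.
Local Open Scope ring_scope.

(** * Binomial and parity sums *)

(** The common inductive step of the Leibniz rule, where c i j is the product of
    two derivatives of orders i and j, and of the binomial transform of a
    sequence, where c ignores its second argument. *)
Lemma pascal_sum (V : zmodType) (c : nat -> nat -> V) n :
  \sum_(j < n.+2) c j (n.+1 - j)%N *+ 'C(n.+1, j) =
  \sum_(j < n.+1) c j.+1 (n - j)%N *+ 'C(n, j)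
  + \sum_(j < n.+1) c j (n - j).+1 *+ 'C(n, j).
Proof.
rewrite big_ord_recl bin0 subn0.
under eq_bigr => j _ do rewrite lift0 binS mulrnDr subSS.
rewrite big_split /= addrA addrC; congr (_ + _).
rewrite big_ord_recr /= bin_small // mulr0n addr0.
rewrite [in RHS]big_ord_recl bin0 subn0; congr (_ + _).
by apply: eq_bigr => j _; rewrite lift0 subnSK.
Qed.

Lemma bin_fact_rat n i : (i <= n)%N ->
  n`!%:R * (i`!%:R^-1 * (n - i)`!%:R^-1) = 'C(n, i)%:R :> rat.
Proof.
move=> le_in; rewrite -(bin_fact le_in) !natrM.
by field; rewrite !pnatr_eq0 -!lt0n !fact_gt0.
Qed.

Lemma mul_bin_bin n i j : (i + j <= n)%N ->
  ('C(n, i) * 'C(n - i, j) = 'C(n, j) * 'C(n - j, i))%N.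
Proof.
move=> le_ijn.
have le_i : (i <= n)%N by lia.
have le_j : (j <= n)%N by lia.
have le_jni : (j <= n - i)%N by lia.
have le_inj : (i <= n - j)%N by lia.
apply/eqP; rewrite -(eqn_pmul2r (fact_gt0 i)) -(eqn_pmul2r (fact_gt0 j)).
rewrite -(eqn_pmul2r (fact_gt0 (n - i - j))); apply/eqP.
transitivity n`!.
  by rewrite -(bin_fact le_i) -(bin_fact le_jni); ring.
by rewrite -(bin_fact le_j) -(bin_fact le_inj) subnAC; ring.
Qed.

Lemma sum_even_indices (V : zmodType) (F : nat -> V) K :
  (forall k, (0 < k < K)%N -> F (2 * k).+1 = 0) ->
  \sum_(0 <= j < 2 * K | (1 < j)%N) F j = \sum_(1 <= k < K) F (2 * k)%N.
Proof.
elim: K => [|K IHK] F0; first by rewrite !big_nil.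
rewrite mulnS add2n big_mkcond 2?big_nat_recr //= -big_mkcond /=.
rewrite IHK => [|k /andP[k0 ltkK]]; last by rewrite F0 // k0 ltnW.
case: K {IHK} F0 => [|K] F0; first by rewrite !big_geq // !addr0.
by rewrite [RHS]big_nat_recr //= F0 ?addr0 //= mulnS.
Qed.

Lemma sum_pairs (V : zmodType) (F : nat -> V) K :
  \sum_(j < 2 * K) F j = \sum_(0 <= k < K) (F (2 * k)%N + F (2 * k).+1).
Proof.
elim: K => [|K IHK]; first by rewrite big_ord0 big_nil.
by rewrite big_nat_recr //= -IHK mulnS add2n !big_ord_recr /= addrA.
Qed.

(** The two ends of the range depend on d and e, but the indices that the
    right-hand side omits all have the parity of d. *)
Lemma sum_parity_class (V : zmodType) (H : nat -> V) n d e :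
  (d <= 1)%N -> (e <= 1)%N -> (forall j, odd j = odd d -> H j = 0) ->
  \sum_(j < (2 * n + 2 - d - e).+1) H j = \sum_(0 <= k < n.+1) H (2 * k + 1 - d)%N.
Proof.
move=> d1 e1 H0; transitivity (\sum_(j < 2 * n.+1) H j).
  case: d d1 H0 => [|[|//]] _ H0; case: e e1 => [|[|//]] _.
  - have -> : (2 * n + 2 - 0 - 0).+1 = (2 * n.+1).+1 by lia.
    by rewrite big_ord_recr /= [X in _ + X]H0 ?addr0 // oddM.
  - by have -> : (2 * n + 2 - 0 - 1).+1 = (2 * n.+1)%N by lia.
  - by have -> : (2 * n + 2 - 1 - 0).+1 = (2 * n.+1)%N by lia.
  have -> : (2 * n.+1)%N = (2 * n + 2 - 1 - 1).+2 by lia.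
  by rewrite [in RHS]big_ord_recr /= [X in _ = _ + X]H0 ?addr0 //=; lia.
rewrite sum_pairs; apply: eq_bigr => k _.
case: d d1 H0 => [|[|//]] _ H0.
  by rewrite H0 ?add0r ?subn0 ?addn1 // oddM.
by rewrite addnK (H0 (2 * k).+1) ?addr0 //= oddM.
Qed.

(** * Convolution with Bernoulli numbers *)

Lemma bernoulli_sum n :
  \sum_(j < n.+1) 'C(n, j)%:R * bernoulli j = bernoulli n + (n == 1%N)%:R.
Proof.
have := congr1 ( *%R n`!%:R) (bernoulliE n).
rewrite /fps_mul /fps_add /egf /fps_exp /fps_const.
have -> : n`!%:R * fps_t n = (n == 1%N)%:R.
  by rewrite /fps_t; case: eqP => [->|_]; rewrite ?mulr0 ?mulr1.
move=> <-; rewrite mulr_sumr addrC [in RHS]big_ord_recr [in LHS]big_ord_recr /=.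
rewrite subnn fact0 invr1 subrr !mulr0 addr0 binn mul1r; congr (_ + _).
apply: eq_bigr => -[j /= lt_jn] _; rewrite subn_eq0 leqNgt lt_jn addr0.
by rewrite -(bin_fact_rat (ltnW lt_jn)); ring.
Qed.

Lemma bernoulli0 : bernoulli 0 = 1.
Proof.
have := bernoulli_sum 1; rewrite big_ord_recl big_ord1 /= bin0 bin1 !mul1r.
by rewrite addrC => /addrI.
Qed.

Lemma bernoulli1 : bernoulli 1 = - 2^-1.
Proof.
have := bernoulli_sum 2; rewrite 2!big_ord_recl big_ord1 /= bernoulli0.
rewrite /bump /=; have -> : 'C(2, 1) = 2 by [].
rewrite bin0 binn => E; lra.
Qed.

(** In terms of exponential generating functions: the binomial transform
    multiplies by e^x, and B(x) e^x = B(x) + x for B(x) = x / (e^x - 1). *)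
Lemma bernoulli_binom_transform (V : lmodType rat) (d : nat -> V) n :
  \sum_(m < n.+1) ('C(n, m)%:R * bernoulli (n - m)) *:
     (\sum_(j < m.+1) d j *+ 'C(m, j))
  = \sum_(m < n.+1) ('C(n, m)%:R * bernoulli (n - m)) *: d m + n%:R *: d n.-1.
Proof.
transitivity (\sum_(j < n.+1) \sum_(m < n.+1 | (j <= m)%N)
    ('C(n, m)%:R * bernoulli (n - m) * 'C(m, j)%:R) *: d j).
  rewrite (exchange_big_dep xpredT) //=; apply: eq_bigr => -[m /= lt_mn] _.
  rewrite scaler_sumr (big_ord_widen n.+1 (fun j => _ *: (d j *+ 'C(m, j)))) //=.
  by apply: eq_big => [j|j _]; rewrite ?ltnS // -scalerA scaler_nat.
transitivity (\sum_(j < n.+1) ('C(n, j)%:R *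
     (bernoulli (n - j) + ((n - j)%N == 1%N)%:R)) *: d j).
  apply: eq_bigr => -[j /= le_jn] _; rewrite -scaler_suml; congr (_ *: _).
  rewrite -bernoulli_sum mulr_sumr (reindex_inj rev_ord_inj) /=.
  rewrite -(big_mkord xpredT (fun i => 'C(n, j)%:R * ('C(n - j, i)%:R * bernoulli i))).
  rewrite -(big_mkord (fun i => j <= n.+1 - i.+1)%N
     (fun i => 'C(n, n.+1 - i.+1)%:R * bernoulli (n - (n.+1 - i.+1)) * 'C(n.+1 - i.+1, j)%:R)).
  rewrite (big_cat_nat (n := (n - j).+1)) ?ltnS ?leq_subr //= [X in _ + X]big1_seq ?addr0; last first.
    by move=> i; rewrite mem_index_iota => /andP[]; lia.
  rewrite big_seq_cond [RHS]big_seq.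
  apply: eq_big => [i|i]; rewrite mem_index_iota; first lia.
  move=> /andP[/andP[_ lt_i] _]; rewrite subSS subKn; last lia.
  rewrite mulrAC mulrA; congr (_ * _); rewrite -!natrM; congr (_%:R).
  have le_in : (i <= n)%N by lia.
  by rewrite (bin_sub le_in); apply: mul_bin_bin; lia.
under eq_bigr => j _ do rewrite mulrDr scalerDl.
rewrite big_split /=; congr (_ + _); case: n => [|n].
  by rewrite big_ord1 /= mulr0 !scale0r.
rewrite 2!big_ord_recr /= subnn mulr0 scale0r addr0 subSnn mulr1 binSn.
rewrite big1 ?add0r // => -[j /= lt_jn] _.
have -> : ((n.+1 - j)%N == 1)%N = false by lia.
by rewrite mulr0 scale0r.
Qed.

Lemma bernoulli_weight_sum n :
  \sum_(m < n.+1) 'C(n, m)%:R * bernoulli (n - m) = bernoulli n + (n == 1%N)%:R.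
Proof.
rewrite -bernoulli_sum (reindex_inj rev_ord_inj); apply: eq_bigr => i _ /=.
have le_in : (i <= n)%N by rewrite -ltnS.
by rewrite subSS bin_sub // subKn.
Qed.

(** * The derivation of a Riccati equation on polynomials *)

(** The derivation d/dt on polynomials in a function g with g' = (g^2 - 1) / 2,
    such as g(t) = - tanh(t/2). *)
Definition riccati (p : {poly rat}) : {poly rat} :=
  p^`() * (2^-1 *: ('X^2 - 1)).

Fact riccati_is_linear : linear riccati.
Proof. by move=> c p q; rewrite /riccati linearP mulrDl scalerAl. Qed.
HB.instance Definition _ := GRing.isLinear.Build rat {poly rat} {poly rat} _
  riccati riccati_is_linear.

Lemma riccatiM p q : riccati (p * q) = riccati p * q + p * riccati q.
Proof. by rewrite /riccati derivM; ring. Qed.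

Lemma riccatiC c : riccati c%:P = 0.
Proof. by rewrite /riccati derivC mul0r. Qed.

Lemma polyC2 : 2%:P = 1 + 1 :> {poly rat}.
Proof. by rewrite -polyCD. Qed.

Lemma riccatiX : 2 *: riccati 'X = 'X^2 - 1.
Proof. by rewrite /riccati derivX mul1r scalerA divff // scale1r. Qed.

Fact iter_riccati_is_linear n : linear (iter n riccati).
Proof. by elim: n => // n IHn c p q; rewrite !iterS IHn linearP. Qed.
HB.instance Definition _ n := GRing.isLinear.Build rat {poly rat} {poly rat} _
  (iter n riccati) (iter_riccati_is_linear n).

Lemma iter_riccatiC n c : iter n riccati c%:P = if n == 0%N then c%:P else 0.
Proof. by elim: n => //= n ->; case: n => [|n]; rewrite ?riccatiC ?linear0. Qed.

Lemma iter_riccatiM n p q :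
  iter n riccati (p * q) =
  \sum_(j < n.+1) (iter j riccati p * iter (n - j) riccati q) *+ 'C(n, j).
Proof.
elim: n => [|n IHn]; first by rewrite big_ord1.
rewrite (pascal_sum (fun i j => iter i riccati p * iter j riccati q)) -big_split.
rewrite [LHS]/= IHn linear_sum /=; apply: eq_bigr => j _.
by rewrite linearMn /= riccatiM mulrnDl.
Qed.

(** The polynomial that expresses the a-th derivative of - tanh(t/2) in terms of
    - tanh(t/2) itself. *)
Definition dtanh a : {poly rat} := iter a riccati 'X.

(** Read at X = g(t), the operator 1 + D is e^(-t) D e^t, and
    e^t (g + 1) = 1 - g.  Hence the sum, (1 + D)^n (g + 1), equals
    - e^(-t) D^n (g - 1); the factors X - 1 and X + 1 clear
    e^(-t) = (1 + g) / (1 - g), which is not a polynomial in g. *)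
Lemma binom_riccati n :
  ('X - 1) * \sum_(j < n.+1) iter j riccati ('X + 1) *+ 'C(n, j)
  = ('X + 1) * iter n riccati ('X - 1).
Proof.
elim: n => [|n IHn]; first by rewrite big_ord1 /= mulr1n mulrC.
rewrite (pascal_sum (fun j _ => iter j riccati ('X + 1))) /=.
set U := \sum_(j < n.+1) _ *+ _ in IHn *.
have -> : \sum_(j < n.+1) riccati (iter j riccati ('X + 1)) *+ 'C(n, j) = riccati U.
  by rewrite linear_sum; apply: eq_bigr => j _; rewrite linearMn.
set V := iter n riccati _ in IHn *.
have := congr1 riccati IHn; rewrite !riccatiM !linearD !linearN /= riccatiC.
have DX := riccatiX; move: DX; rewrite -mul_polyC; set q := riccati 'X => DX.
move=> E; suff : 2%:P * (('X - 1) * (riccati U + U) - ('X + 1) * riccati V) = 0.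
  by move/eqP; rewrite mulf_eq0 polyC_eq0 subr_eq0 => /eqP.
rewrite polyC2 in DX *; move: E DX IHn; rewrite subr0 addr0.
move: U V q (riccati U) (riccati V) => u v q du dv E DX IHn.
have -> : (1 + 1) * (('X - 1) * (du + u) - ('X + 1) * dv)
  = (1 + 1) * (q * u + ('X - 1) * du - (q * v + ('X + 1) * dv))
    + ((1 + 1) * q) * (v - u) + (1 + 1) * (('X - 1) * u) by ring.
rewrite E subrr mulr0 add0r DX.
transitivity (('X - 1) * (('X + 1) * v - ('X - 1) * u)); first ring.
by rewrite IHn subrr mulr0.
Qed.

Lemma dtanh_add1 a : iter a riccati ('X + 1) = dtanh a + (a == 0%N)%:R.
Proof. by rewrite linearD /= -[1]/(1%:P) iter_riccatiC; case: a. Qed.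

Lemma dtanh_sub1 a : iter a riccati ('X - 1) = dtanh a - (a == 0%N)%:R.
Proof. by rewrite linearB /= -[1]/(1%:P) iter_riccatiC; case: a. Qed.

(** X plays the role of an odd function of t, whose derivatives alternate in
    parity; here the parity is that in X. *)
Lemma dtanh_odd a : dtanh a \Po (- 'X) = (-1) ^+ a.+1 *: dtanh a.
Proof.
elim: a => [|a IHa]; first by rewrite comp_polyX expr1 scaleN1r.
rewrite /= -/(dtanh a) {1}/riccati comp_polyM.
have -> : (2^-1 *: ('X^2 - 1) : {poly rat}) \Po - 'X = 2^-1 *: ('X^2 - 1).
  by rewrite comp_polyZ comp_polyB comp_Xn_poly sqrrN rmorph1.
have := congr1 (@deriv rat) IHa; rewrite deriv_comp derivN derivX mulrN1 derivZ.
move/(congr1 -%R); rewrite opprK => ->.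
by rewrite /riccati -scaleNr -scalerAl !exprS !mulN1r ?opprK.
Qed.

Lemma dtanh_even0 a : ~~ odd a -> (dtanh a).[0] = 0.
Proof.
move=> ev; have := congr1 (horner^~ 0) (dtanh_odd a).
rewrite horner_comp hornerN hornerX oppr0 hornerZ -signr_odd /= ev expr1 => E.
lra.
Qed.

(** The addition theorem g(t+x) = (g(t) + g(x)) / (1 + g(t) g(x)), with
    denominators cleared: this is the coefficient of x^n / n! in
    (g - 1) (e^x g(t+x) + e^x) = (g + 1) (g(t+x) - 1). *)
Lemma binom_dtanh n :
  ('X - 1) * (\sum_(j < n.+1) dtanh j *+ 'C(n, j) + 1)
  = ('X + 1) * (dtanh n - (n == 0%N)%:R).
Proof.
rewrite -dtanh_sub1 -binom_riccati; congr (_ * _).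
under [in RHS]eq_bigr => j _ do rewrite dtanh_add1 mulrnDl.
rewrite big_split /=; congr (_ + _).
by rewrite big_ord_recl /= bin0 big1 ?addr0 // => j _; rewrite mul0rn.
Qed.

(** * Genocchi numbers as derivatives at the origin *)

(** Comparison of coefficients in f (e^t + 1) = 2, where f = 2 / (e^t + 1) is the
    Genocchi series divided by t. *)
Lemma genocchi_binom m :
  \sum_(i < m.+1) 'C(m, i)%:R * (genocchi i.+1 / i.+1%:R) + genocchi m.+1 / m.+1%:R
  = 2 * (m == 0%N)%:R.
Proof.
have egfE i : egf genocchi i.+1 = i`!%:R^-1 * (genocchi i.+1 / i.+1%:R).
  by rewrite /egf factS natrM invfM; ring.
have := congr1 ( *%R m`!%:R) (genocchiE m.+1).
have -> : m`!%:R * fps_scale 2 fps_t m.+1 = 2 * (m == 0%N)%:R.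
  by rewrite /fps_scale /fps_t eqSS; case: m => [|m] //=; rewrite !mulr0.
move=> <-; rewrite /fps_mul /fps_add /fps_exp /fps_const.
have egf0 : egf genocchi 0 = 0 by rewrite /egf genocchi0 mul0r.
rewrite [in RHS]big_ord_recl egf0 mul0r add0r.
rewrite mulr_sumr.
under [in RHS]eq_bigr => i _ do rewrite lift0 egfE subSS mulrDr mulrDr.
rewrite big_split /=; congr (_ + _).
  apply: eq_bigr => i _; have le_im : (i <= m)%N by rewrite -ltnS.
  by rewrite -(bin_fact_rat le_im) [in RHS]mulrAC [RHS]mulrA.
rewrite big_ord_recr big1 /= => [|i _].
  by rewrite add0r subnn mulr1 mulrA mulfV ?mul1r // pnatr_eq0 -lt0n fact_gt0.
by rewrite subn_eq0 leqNgt ltn_ord !mulr0.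
Qed.

(** Multiplication by e^t + 1 is injective because its constant term is 2. *)
Lemma binom_add_self_inj (u v : nat -> rat) :
  (forall m, \sum_(i < m.+1) 'C(m, i)%:R * u i + u m
           = \sum_(i < m.+1) 'C(m, i)%:R * v i + v m) ->
  forall m, u m = v m.
Proof.
move=> uv; elim/ltn_ind => m IHm; have := uv m.
rewrite !big_ord_recr binn /= (eq_bigr (fun i : 'I_m => 'C(m, i)%:R * v i)) => [|i _].
  by move=> E; lra.
by rewrite IHm.
Qed.

(** Both sides satisfy genocchi_binom: for the right one, which is the sequence of
    derivatives at 0 of 1 + g, this is binom_dtanh at X = 0. *)
Lemma genocchi_dtanh m :
  genocchi m.+1 / m.+1%:R = (dtanh m).[0] + (m == 0%N)%:R.
Proof.
move: m; apply: (@binom_add_self_inj (fun i => genocchi i.+1 / i.+1%:R)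
  (fun i => (dtanh i).[0] + (i == 0%N)%:R)) => m.
rewrite genocchi_binom; apply/esym.
under eq_bigr => j _ do rewrite mulrDr.
rewrite big_split /= [X in _ + X + _]big_ord_recl /= bin0 mulr1.
rewrite [X in _ + (_ + X) + _]big1 => [|j _]; last by rewrite mulr0.
have E := congr1 (horner^~ 0) (binom_dtanh m).
rewrite !hornerE horner_sum -polyC_natr hornerC in E.
under eq_bigr => j _ do rewrite mulr_natl -hornerMn.
by rewrite /=; lra.
Qed.

Lemma genocchi_even m : (0 < m)%N ->
  genocchi (2 * m) / m%:R = 2 * (dtanh (2 * m).-1).[0].
Proof.
case: m => // m _; have := genocchi_dtanh (2 * m).+1.
rewrite mulnS add2n addr0 /= => <-.
have -> : (2 * m).+2%:R = 2 * m.+1%:R :> rat by rewrite -natrM mulnS.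
by field; rewrite -(natrD _ 1) pnatr_eq0.
Qed.

(** * Multiplication of a derivative by X *)

(** Convolution of binom_dtanh with the Bernoulli numbers.  The term
    n D^(n-1) X comes from B(x) (e^x + 1) = 2 B(x) + x. *)
Lemma bernoulli_dtanh n :
  n%:R *: ('X * dtanh n.-1) =
  2 *: (\sum_(m < n.+1) ('C(n, m)%:R * bernoulli m) *: dtanh (n - m))
  + n%:R *: dtanh n.-1
  - (bernoulli n + (n == 1%N)%:R) *: ('X - 1) - bernoulli n *: ('X + 1).
Proof.
have -> : \sum_(m < n.+1) ('C(n, m)%:R * bernoulli m) *: dtanh (n - m)
        = \sum_(m < n.+1) ('C(n, m)%:R * bernoulli (n - m)) *: dtanh m.
  rewrite (reindex_inj rev_ord_inj); apply: eq_bigr => i _ /=.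
  have le_in : (i <= n)%N by rewrite -ltnS.
  by rewrite subSS bin_sub // subKn.
pose w m := 'C(n, m)%:R * bernoulli (n - m).
pose E m := \sum_(j < m.+1) dtanh j *+ 'C(m, j).
have key := bernoulli_binom_transform dtanh n.
rewrite -/(w _) in key.
have rel m : 'X * E m = 'X * dtanh m + E m + dtanh m - ('X - 1) - (m == 0%N)%:R * ('X + 1).
  apply/eqP; rewrite -subr_eq0.
  transitivity (('X - 1) * (E m + 1) - ('X + 1) * (dtanh m - (m == 0%N)%:R) == 0).
    by congr (_ == _); ring.
  by rewrite binom_dtanh subrr eqxx.
have : 'X * (\sum_(m < n.+1) w m *: E m) = \sum_(m < n.+1) w m *: ('X * E m).
  by rewrite mulr_sumr; apply: eq_bigr => m _; rewrite scalerAr.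
under [in RHS]eq_bigr => m _ do rewrite rel !scalerDr !scalerN.
rewrite !big_split /= !sumrN -scaler_suml bernoulli_weight_sum key.
have -> : \sum_(m < n.+1) w m *: ('X * dtanh m) = 'X * (\sum_(m < n.+1) w m *: dtanh m).
  by rewrite mulr_sumr; apply: eq_bigr => m _; rewrite scalerAr.
have -> : \sum_(m < n.+1) w m *: ((m == 0%N :> nat)%:R * ('X + 1)) = bernoulli n *: ('X + 1).
  rewrite big_ord_recl big1 /= => [|m _]; last by rewrite mul0r scaler0.
  by rewrite /w bin0 subn0 !mul1r addr0.
rewrite mulrDr -!addrA => /addrI; rewrite scalerAr => ->.
by rewrite !scaler_nat; ring.
Qed.

(** In bernoulli_dtanh at order a + 1, the summand of index 1 cancels the second
    term, and the summand of index a + 1 the last two; for a = 0 these indices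
    coincide and the constant 1 is left over. *)
Lemma dtanh_mulX a :
  a.+1%:R *: ('X * dtanh a) =
  2 *: (\sum_(j < a.+1 | j != 1%N :> nat)
          ('C(a.+1, j)%:R * bernoulli j) *: dtanh (a.+1 - j))
  + (a == 0%N)%:R.
Proof.
have := bernoulli_dtanh a.+1; rewrite big_ord_recr /= binn mul1r subnn => ->.
case: a => [|a].
  rewrite big_ord1 big_mkcond big_ord1 /=.
  rewrite bin0 bernoulli1 bernoulli0 mul1r !scale1r (_ : - 2^-1 + 1 = 2^-1) //.
  have hh : 2%:P * (2^-1)%:P = 1 :> {poly rat} by rewrite -polyCM divff.
  rewrite polyC2 in hh; rewrite -!mul_polyC !polyCN polyC2.
  move: (riccati _) (2^-1)%:P hh => q c hh.
  transitivity ((1 + 1) * q + 'X + (1 - 'X) * ((1 + 1) * c)); first by ring.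
  by rewrite hh; ring.
rewrite addr0 (bigD1 (Ordinal (isT : 1 < a.+2)%N)) //= bin1 bernoulli1.
set S := (X in _ = 2 *: X + _); rewrite addr0.
set S' := (X in _ + X + _ *: 'X); rewrite (_ : S' = S) //.
rewrite 2!scalerDr scalerA (_ : 2 * _ = - a.+2%:R); last by field.
by rewrite scaleNr -!mul_polyC polyC2; ring.
Qed.

(** At X = 0 the formula dtanh_mulX for odd a loses its left-hand side, its terms
    with even j (there D^(a+1-j) X is an odd polynomial) and, by induction, those
    with odd j < a.  What is left is a nonzero multiple of the Bernoulli number
    of index a. *)
Lemma bernoulli_odd a : odd a -> (1 < a)%N -> bernoulli a = 0.
Proof.
elim/ltn_ind: a => a IHa odd_a a_gt1.
have := congr1 (horner^~ 0) (dtanh_mulX a).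
have -> : (a == 0%N) = false by lia.
rewrite addr0 !hornerZ hornerM hornerX mul0r mulr0 horner_sum.
rewrite big_mkcond big_ord_recr /= big1 => [|[j /= lt_ja] _]; last first.
  case: eqP => //= j1; rewrite hornerZ.
  have [odd_j|even_j] := boolP (odd j).
    by rewrite IHa ?mulr0 ?mul0r //; lia.
  by rewrite dtanh_even0 ?mulr0 //; lia.
have -> : a != 1%N by lia.
rewrite add0r hornerZ subSnn binSn.
have -> : (dtanh 1).[0] = - 2^-1.
  by rewrite /dtanh /= /riccati derivX mul1r !hornerE; field.
move=> E; have /eqP : a.+1%:R * bernoulli a = 0 by lra.
by rewrite mulf_eq0 pnatr_eq0 => /eqP.
Qed.

(** * The coefficients rho *)

(** Pascal's rule holds for every integer lower index, including the boundary
    case y = -1. *)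
Lemma binzS x (y : int) : binz x.+1 (y + 1) = (binz x (y + 1) + binz x y)%N.
Proof.
case: y => [m|[|m]].
- by rewrite addrC -[1]/(1%:Z) -PoszD add1n.
- by rewrite NegzE addNr /= !bin0.
by rewrite NegzE (_ : - m.+2%:Z + 1 = - m.+1%:Z) -?NegzE //; lia.
Qed.

(** For k = 0 this is the Beta integral recursion
    x^(a+1) (1-x)^b + x^a (1-x)^(b+1) = x^a (1-x)^b. *)
Lemma rhoS k a b : rho k a.+1 b + rho k a b.+1 = rho k a b.
Proof.
rewrite /rho; case: eqP => _.
  rewrite !addn1 addnS addSn (factS (a + b).+1) !factS !natrM.
  by field; rewrite -natrD -(natrD _ 1) -(natrD _ 2) !pnatr_eq0 -lt0n fact_gt0.
pose y : int := a%:Z + b%:Z + 1 - 2 * k%:Z.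
rewrite -/y (_ : a.+1%:Z + b%:Z + 1 - 2 * k%:Z = y + 1); last by rewrite /y; lia.
rewrite (_ : a%:Z + b.+1%:Z + 1 - 2 * k%:Z = y + 1); last by rewrite /y; lia.
by rewrite !binzS !natrD !exprS; ring.
Qed.

Lemma rho_pos k a b : (0 < k)%N -> (2 * k <= a + b)%N ->
  rho k a b = (-1) ^+ a * 'C(b, a + b + 1 - 2 * k)%:R
            + (-1) ^+ b * 'C(a, a + b + 1 - 2 * k)%:R.
Proof.
move=> k0 le_k; rewrite /rho; case: eqP; first lia.
by rewrite (_ : a%:Z + b%:Z + 1 - 2 * k%:Z = (a + b + 1 - 2 * k)%N) //; lia.
Qed.

(** At 2k = a + b + 1 both binomials are 1 and the signs are opposite, because a
    and b have different parities; beyond that the lower index is negative. *)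
Lemma rho_eq0 k a b : (a + b < 2 * k)%N -> rho k a b = 0.
Proof.
move=> lt_k; rewrite /rho; case: eqP; first lia.
move=> _; case E : (a%:Z + b%:Z + 1 - 2 * k%:Z) => [[|m]|m] /=; try by rewrite !mulr0 addr0.
  rewrite !bin0 !mulr1 -signr_odd -[in X in _ + X]signr_odd.
  have -> : odd a = ~~ odd b by lia.
  by case: (odd b); rewrite /= ?expr0 ?expr1; ring.
by lia.
Qed.

(** * Products of derivatives *)

(** The case b = 0 of the product formula: only even Bernoulli indices survive, and
    C(a+1, 2k) = (a+1) / (2k) C(a, 2k-1) produces rho_k(a, 0). *)
Lemma dtanh_mulX_rho a K : (a < 2 * K)%N ->
  'X * dtanh a = (2 * rho 0 a 0) *: dtanh a.+1
   + \sum_(1 <= k < K) (rho k a 0 * (bernoulli (2 * k) / k%:R)) *: dtanh (a + 1 - 2 * k)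
   + (a == 0%N)%:R.
Proof.
move=> lt_aK; have a1 : a.+1%:R != 0 :> rat by rewrite pnatr_eq0.
apply: (scalerI a1); rewrite dtanh_mulX 2!scalerDr; congr (_ + _); last first.
  by case: a {lt_aK a1} => [|a]; rewrite ?scale1r // scaler0.
have -> : rho 0 a 0 = a.+1%:R^-1.
  rewrite /rho /= addn0 muln1 addn1 factS natrM invfM mulrCA mulfV ?mulr1 //.
  by rewrite pnatr_eq0 -lt0n fact_gt0.
rewrite scalerA mulrCA mulfV // mulr1.
rewrite (bigD1 ord0) //= bin0 bernoulli0 mul1r scale1r scalerDr; congr (_ + _).
(* F 0 and F 1 are excluded from the sum, and F j = 0 for j > a makes the
   summation bound 2 K irrelevant. *)
pose F j := if (j <= a)%N then ('C(a.+1, j)%:R * bernoulli j) *: dtanh (a.+1 - j) else 0.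
transitivity (2 *: \sum_(0 <= j < 2 * K | (1 < j)%N) F j).
  congr (_ *: _); rewrite big_mkord (big_ord_widen_cond (2 * K) (fun j => (j != 1%N) && (j != 0%N))
    (fun j => ('C(a.+1, j)%:R * bernoulli j) *: dtanh (a.+1 - j))) //.
  rewrite big_mkcond [RHS]big_mkcond; apply: eq_bigr => j _; rewrite /F ltnS.
  by case: (val j) => [|[|i]] //=; case: ifP.
rewrite (@sum_even_indices _ F) => [|k /andP[k0 _]]; last first.
  by rewrite /F; case: ifP => // _; rewrite bernoulli_odd ?mulr0 ?scale0r //=; lia.
rewrite !scaler_sumr; apply: eq_big_nat => k /andP[k0 _].
rewrite /F; case: leqP => [le_ka|lt_ak]; last first.
  by rewrite rho_eq0 ?addn0 // mul0r scale0r !scaler0.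
rewrite rho_pos ?addn0 // addn1 !scalerA; congr (_ *: _).
rewrite (@bin_small 0) ?mulr0 ?add0r; last lia.
rewrite expr0 mul1r.
have -> : 'C(a, a.+1 - 2 * k) = 'C(a, (2 * k).-1).
  by rewrite -[in LHS]bin_sub; [congr binomial|]; lia.
have := mul_bin_diag a.+1 (2 * k).-1; rewrite prednK /=; last lia.
move/(congr1 (fun m => m%:R : rat)); rewrite !natrM => E.
rewrite !mulrA E -natrM.
by field; rewrite pnatr_eq0 -lt0n.
Qed.

Lemma riccati_dtanh a : riccati (dtanh a) = dtanh a.+1.
Proof. by []. Qed.

(** The bound K is arbitrary since rho k a b vanishes for 2k > a + b; this lets the
    three pairs (a, b), (a+1, b) and (a, b+1) of the induction share one range of
    summation. *)
Lemma dtanh_mul a b K : (a + b < 2 * K)%N ->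
  dtanh a * dtanh b =
   (2 * rho 0 a b) *: dtanh (a + b + 1)
   + \sum_(1 <= k < K) (rho k a b * (bernoulli (2 * k) / k%:R)) *: dtanh (a + b + 1 - 2 * k)
   + ((a + b)%N == 0%N)%:R.
Proof.
elim: b a => [|b IHb] a lt_abK.
  by rewrite addn0 in lt_abK *; rewrite mulrC (dtanh_mulX_rho lt_abK) addn1.
have lt1 : (a + b < 2 * K)%N by lia.
have lt2 : (a.+1 + b < 2 * K)%N by lia.
have E := congr1 riccati (IHb _ lt1); rewrite riccatiM !riccati_dtanh in E.
(* D^a X D^(b+1) X is the derivative of the product at (a, b) minus the
   product at (a+1, b), both known by induction. *)
apply: (addrI (dtanh a.+1 * dtanh b)); rewrite E (IHb _ lt2).
rewrite !linearD /= linearZ linear_sum /= riccati_dtanh.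
have -> : riccati ((a + b)%N == 0%N)%:R = 0 by rewrite -polyC_natr riccatiC.
have -> : ((a + b.+1)%N == 0%N) = false by lia.
have s1 : (a.+1 + b + 1 = (a + b + 1).+1)%N by lia.
have s2 : (a + b.+1 + 1 = (a + b + 1).+1)%N by lia.
rewrite !addr0 s1 s2 addrACA -scalerDl -mulrDr rhoS; congr (_ + _).
rewrite -big_split /=; apply: eq_big_nat => k /andP[k0 _].
rewrite -scalerDl -mulrDl rhoS linearZ /= riccati_dtanh.
have [le_k|lt_k] := leqP (2 * k) (a + b); last by rewrite rho_eq0 // mul0r !scale0r.
by congr (_ *: dtanh _); lia.
Qed.

Lemma iter_riccati_dtanh n a : iter n riccati (dtanh a) = dtanh (n + a).
Proof. by rewrite /dtanh iterD. Qed.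

Theorem theorem5p1 (n alpha gamma delta eps : nat)
    (hdelta : delta \in [:: 0; 1]%N) (heps : eps \in [:: 0; 1]%N) :
  \sum_(0 <= k < n.+1)
     ('C(2 * n + 2 - delta - eps, 2 * k + 1 - delta))%:R
     * (genocchi (2 * k + 2 * alpha + 2) / (k + alpha + 1)%:R)
     * (genocchi (2 * (n - k) + 2 * gamma + 2) / (n - k + gamma + 1)%:R)
  = 4 * rho 0 (2 * alpha + delta) (2 * gamma + eps)
      * (genocchi (2 * n + 2 * alpha + 2 * gamma + 4)
         / (n + alpha + gamma + 2)%:R)
    + 2 * \sum_(1 <= k < (alpha + gamma + (delta + eps) %/ 2).+1)
            rho k (2 * alpha + delta) (2 * gamma + eps)
            * (bernoulli (2 * k) / k%:R)
            (* k may exceed n: subtract last, so that nat subtraction is exact *)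
            * (genocchi (2 * n + 2 * alpha + 2 * gamma + 4 - 2 * k)
               / (n + alpha + gamma + 2 - k)%:R).
Proof.
have d1 : (delta <= 1)%N by move: hdelta; rewrite !inE => /orP[] /eqP ->.
have e1 : (eps <= 1)%N by move: heps; rewrite !inE => /orP[] /eqP ->.
set a := (2 * alpha + delta)%N; set b := (2 * gamma + eps)%N.
set K := (alpha + gamma + (delta + eps) %/ 2).+1.
set N := (2 * n + 2 - delta - eps)%N.
have lt_abK : (a + b < 2 * K)%N by rewrite /a /b /K; lia.
have := congr1 (fun p => (iter N riccati p).[0]) (dtanh_mul lt_abK).
rewrite /= iter_riccatiM !linearD /= linearZ linear_sum /= !hornerD hornerZ !horner_sum.
(* For N = 0 one has delta = eps = 1, hence a + b > 0. *)
have -> : (iter N riccati ((a + b)%N == 0%N)%:R).[0] = 0.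
  rewrite -polyC_natr iter_riccatiC; case: eqP => [N0|_]; last by rewrite horner0.
  by rewrite hornerC (_ : _ == _ = false) //; rewrite /a /b; lia.
rewrite addr0.
pose u i := (dtanh i).[0].
pose G j := 'C(N, j)%:R * u (j + a)%N * u (N - j + b)%N.
rewrite [X in X = _ -> _](eq_bigr (fun j : 'I_N.+1 => G j)) => [|j _]; last first.
  by rewrite hornerMn hornerM !iter_riccati_dtanh -mulr_natl mulrA.
rewrite iter_riccati_dtanh => E.
transitivity (4 * \sum_(j < N.+1) G j).
  (* For j of the parity of delta, the order j + a is even. *)
  have G0 j : odd j = odd delta -> G j = 0.
    move=> par; rewrite /G /u dtanh_even0 ?mulr0 ?mul0r //.
    by rewrite /a oddD par oddD oddM /= addbb.
  rewrite (sum_parity_class _ d1 e1 G0) mulr_sumr; apply: eq_big_nat => k /andP[_ lt_kn].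
  rewrite [(2 * k + 2 * alpha + 2)%N](_ : _ = 2 * (k + alpha + 1))%N; last lia.
  rewrite [(2 * (n - k) + 2 * gamma + 2)%N](_ : _ = 2 * (n - k + gamma + 1))%N; last lia.
  rewrite !genocchi_even; [|lia|lia].
  rewrite /G /u.
  have -> : (2 * k + 1 - delta + a = (2 * (k + alpha + 1)).-1)%N by rewrite /a; lia.
  have -> : (N - (2 * k + 1 - delta) + b = (2 * (n - k + gamma + 1)).-1)%N.
    by rewrite /N /b; lia.
  by ring.
rewrite E mulrDr; congr (_ + _).
  have -> : (2 * n + 2 * alpha + 2 * gamma + 4 = 2 * (n + alpha + gamma + 2))%N by lia.
  rewrite genocchi_even; last lia.
  have -> : (2 * (n + alpha + gamma + 2)).-1 = (N + (a + b + 1))%N by rewrite /N /a /b; lia.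
  by ring.
rewrite !mulr_sumr; apply: eq_big_nat => k /andP[k0 lt_kK].
have -> : (2 * n + 2 * alpha + 2 * gamma + 4 - 2 * k = 2 * (n + alpha + gamma + 2 - k))%N by lia.
rewrite genocchi_even; last by move: lt_kK; rewrite /K; lia.
have -> : (2 * (n + alpha + gamma + 2 - k)).-1 = (N + (a + b + 1 - 2 * k))%N.
  by move: lt_kK; rewrite /N /a /b /K; lia.
by rewrite linearZ /= hornerZ iter_riccati_dtanh; ring.
Qed.
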